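(* Let $V\subset\mathbb R^D$ be a polytope with $0\in V$, let $U:=\operatorname{vert}(V)$ be its vertex set, let $A\colon\mathbb R^D\to\mathbb R^D$ be linear, and suppose that $\tfrac12(A+A^{\mathsf T})$ is positive definite. Then there is a constant $C_{\mathrm w}=C_{\mathrm w}(\mathbb R^D,U,A)\ge1$, depending only on $D$, $U$ and $A$, such that the following holds. Let $\overline w,B\ge0$. If, for every integer $k\ge0$, $$z_{k+1}=z_k+w_ku_k,\qquad 0\le w_k\le\overline w,\qquad u_k\in U,$$ and $$\langle Az_k,u_k\rangle\le\min_{v\in V}\langle Az_k,v\rangle+B,$$ then $$\sup_{k\ge0}\|z_k\|\le C_{\mathrm w}\bigl(\overline w+\|z_0\|+B\bigr).$$ In particular, exact vertex minimizers $u_k\in U\cap\operatorname{argmin}_{v\in V}\langle Az_k,v\rangle$ are covered with $B=0$.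
   Context: $\mathbb R^D$ carries the standard inner product and Euclidean norm. A polytope is the convex hull of a nonempty finite set of points. In the paper, $C_{\mathrm w}(E,U,A)$ denotes the constant of the weighted-update bound: for a finite set $U$ with $0\in\operatorname{conv}U$ and coercive linear $A$ on $E$, every recursion $z_{k+1}=z_k+w_ku_k$ with $0\le w_k\le\overline w$, $u_k\in U$ and $\langle Az_k,u_k\rangle\le\min_{u\in U}\langle Az_k,u\rangle+B$ satisfies $\sup_k\|z_k\|\le C_{\mathrm w}(E,U,A)(\overline w+\|z_0\|+B)$. *)

(* Defs.v *)
From HB Require Import structures.
From mathcomp Require Import all_boot all_order all_algebra.
From mathcomp Require Import all_classical all_reals all_analysis.

Set Implicit Arguments.
Unset Strict Implicit.
Unset Printing Implicit Defensive.

Import Order.TTheory GRing.Theory Num.Theory.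

Local Open Scope classical_set_scope.
Local Open Scope ring_scope.

(* R^D is the space 'cV[R]_D of column vectors, and a linear map of R^D is
   its matrix, acting by z |-> A *m z. *)

Definition dotp (R : realType) (D : nat) (x y : 'cV[R]_D) : R :=
  \sum_(i < D) x i ord0 * y i ord0.

(* The library's norm `|x| on matrices is the maximum norm. *)
Definition enorm (R : realType) (D : nat) (x : 'cV[R]_D) : R :=
  Num.sqrt (dotp x x).

Definition conv_hull (R : realType) (D : nat) (S : set 'cV[R]_D) :
    set 'cV[R]_D :=
  smallest (@convex_set R 'cV[R]_D) S.

Definition polytope (R : realType) (D : nat) (V : set 'cV[R]_D) : Prop :=
  exists S : set 'cV[R]_D, [/\ finite_set S, S !=set0 & V = conv_hull S].

(* The vertices of a polytope are its extreme points. *)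
Definition vert (R : realType) (D : nat) (V : set 'cV[R]_D) : set 'cV[R]_D :=
  [set v | V v /\ forall (x y : 'cV[R]_D) (t : R),
     V x -> V y -> 0 < t < 1 -> v = t *: x + (1 - t) *: y -> x = v /\ y = v].

Definition posdefmx (R : realType) (D : nat) (M : 'M[R]_D) : Prop :=
  M^T = M /\ forall x : 'cV[R]_D, x != 0 -> 0 < dotp (M *m x) x.

Definition argmin (R : realType) (T : Type) (V : set T) (f : T -> R) : set T :=
  [set v | V v /\ forall w, V w -> f v <= f w].

(* This is the minimum whenever it is attained, as it is for a linear form on
   a polytope (polytope_minE); on other sets the value is the infimum. *)
Definition minval (R : realType) (T : Type) (V : set T) (f : T -> R) : R :=
  inf (f @` V).

Lemma argmin_minval (R : realType) (T : Type) (V : set T) (f : T -> R) (v : T) :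
  argmin V f v -> minval V f = f v.
Proof.
move=> [Vv vmin]; apply/eqP; rewrite eq_le; apply/andP; split.
  apply: ge_inf; last by exists v.
  by exists (f v) => _ [w Vw <-]; exact: vmin.
by apply: lb_le_inf; [exists (f v), v | move=> _ [w Vw <-]; exact: vmin].
Qed.

Lemma dotpDr (R : realType) (D : nat) (a x y : 'cV[R]_D) :
  dotp a (x + y) = dotp a x + dotp a y.
Proof.
by rewrite -big_split/=; apply: eq_bigr => i _; rewrite mxE mulrDr.
Qed.

Lemma dotpZr (R : realType) (D : nat) (a x : 'cV[R]_D) (t : R) :
  dotp a (t *: x) = t * dotp a x.
Proof.
by rewrite /dotp mulr_sumr; apply: eq_bigr => i _; rewrite mxE mulrCA.
Qed.

Lemma polytope_argmin (R : realType) (D : nat) (V : set 'cV[R]_D)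
    (a : 'cV[R]_D) :
  polytope V -> argmin V (dotp a) !=set0.
Proof.
move=> [S [/finite_seqP[s ->] [x0 /= x0s] ->]].
have [v vs vmin] : exists2 v, v \in s & {in s, forall w, dotp a v <= dotp a w}.
  elim: s x0 x0s => // y s IH x0 _.
  case: s IH => [_|z s /(_ z)].
    by exists y; rewrite ?mem_head// => w; rewrite inE => /eqP ->.
  rewrite mem_head => /(_ isT)[v vs vmin].
  have [yv|vy] := leP (dotp a y) (dotp a v).
    exists y; rewrite ?mem_head// => w; rewrite inE => /orP[/eqP -> //|ws].
    exact: le_trans yv (vmin _ ws).
  exists v; first by rewrite inE vs orbT.
  by move=> w; rewrite inE => /orP[/eqP ->|/vmin//]; exact: ltW.
exists v; split; first by move=> C [_ sC]; exact: sC.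
move=> w /(_ [set w | dotp a v <= dotp a w]); apply; split => //= x y t.
rewrite !inE/= => xv yv.
rewrite /conv/= dotpDr !dotpZr.
have t0 : 0 <= t%:num by [].
have t1 : t%:num <= 1 by [].
rewrite (_ : dotp a v = t%:num * dotp a v + (1 - t%:num) * dotp a v).
  by apply: lerD; apply: ler_wpM2l => //; rewrite subr_ge0.
by rewrite -mulrDl addrC subrK mul1r.
Qed.

Lemma polytope_minE (R : realType) (D : nat) (V : set 'cV[R]_D)
    (a : 'cV[R]_D) :
  polytope V -> exists2 v, argmin V (dotp a) v & minval V (dotp a) = dotp a v.
Proof.
by move=> /(@polytope_argmin _ _ _ a)[v av]; exists v => //; exact: argmin_minval.
Qed.

(* Main.v *)
Require Import Defs.
From mathcomp Require Import all_boot all_order all_algebra.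
From mathcomp Require Import all_classical all_reals all_analysis.
From mathcomp Require Import lra ring.

(** Write b(x, y) = <A x, y>, and let p_1, ..., p_n be the vertices.

    In continuous time the support function z |-> max_j - b(z, p_j) is a
    Lyapunov function: a trajectory sliding with velocity v along the face of
    current minimizers decreases it at rate b(v, v) >= 0. In discrete time the
    trajectory zigzags between the vertices of such a face, so the proof uses a
    potential that is adapted to every possible set F of minimizers:

      Phi(z) = max over nonempty F of  M K^|F| - b(z, v_F),

    where v_F is a convex combination of F, with all weights positive, such
    that b(p_i, v_F) >= 0 for every i in F. Any update along a vertex of F then
    cannot increase the F-term. Such a v_F exists by Farkas' lemma and the
    positivity of A ([positive_weights]). The offsets M K^|F| grow so fast that
    a set F attaining the maximum contains every vertex that is within M of
    minimizing b(z, .) ([maximal_face_near_min]): otherwise adding the missing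
    vertex to F would give a larger term. With M comparable to wbar + B, the
    vertex used by an update therefore belongs to the set attaining the maximum
    after the update, and Phi never increases ([potential_step]).

    Since 0 is in V, the selected vertex satisfies b(z_k, u_k) <= B, which makes
    Phi(z_k) nonnegative. This settles two kinds of updates differently. Call a
    vertex balanced if it has a positive coefficient in some vanishing
    nonnegative combination of vertices. If p_i is not balanced, v_F can be
    chosen with b(p_i, v_F) > 0 whenever i is in F, so each update along p_i
    lowers Phi in proportion to its weight, and the total weight of all such
    updates is bounded. If p_i is balanced, the upper bound on Phi(z), which
    bounds - b(z, p_j) for all j, also bounds b(z, p_i) from above
    ([balanced_bound]); since b is positive definite, this controls the part of
    z_k built from balanced updates ([span_bound]). All the bounds are linear in
    wbar + |z_0| + B. *)

Import Order.TTheory GRing.Theory Num.Theory.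

Local Open Scope classical_set_scope.
Local Open Scope ring_scope.

Set Implicit Arguments.
Unset Strict Implicit.
Unset Printing Implicit Defensive.

(** * Linear inequalities *)

(** Induction on the constraints, after Bartl. If [c] is not already a
    consequence of the tail [s], a point [y] violating it has [a j y > 0];
    restricting every functional to the kernel of [a j] along [y] removes the
    constraint [j], and the multiplier of [j] is read off at [y]. *)
Lemma farkas (R : realFieldType) (V : lmodType R) (J : eqType) (s : seq J)
    (a : J -> V -> R) (c : V -> R) :
  (forall j k x y, a j (k *: x + y) = k * a j x + a j y) ->
  (forall k x y, c (k *: x + y) = k * c x + c y) ->
  uniq s ->
  (forall x, (forall j, j \in s -> a j x <= 0) -> c x <= 0) ->
  exists l : J -> R,
    (forall j, 0 <= l j) /\ forall x, c x = \sum_(j <- s) l j * a j x.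
Proof.
elim: s a c => [|j s IH] a c aL cL.
  move=> _ c_le0; exists (fun=> 0); split=> // x; rewrite big_nil.
  have c0 : c 0 = 0 by have := cL 1 0 0; rewrite scaler0 addr0; lra.
  have cN : c (- x) = - c x.
    by have := cL (-1) x 0; rewrite scaleN1r addr0 c0; lra.
  apply/eqP; rewrite eq_le c_le0//= -oppr_le0 -cN; exact: c_le0.
move=> /= /andP[js s_uniq] c_le0.
have [[y [ay cy]]|noy] :=
  pselect (exists y, (forall i, i \in s -> a i y <= 0) /\ 0 < c y); last first.
  have [||||l [l0 lE]] := IH a c => //.
    by move=> x ax; rewrite leNgt; apply/negP => cx; apply: noy; exists x.
  exists (fun i => if i == j then 0 else l i); split=> [i|x]; first by case: ifP.
  rewrite big_cons eqxx mul0r add0r lE; apply: eq_big_seq => i si.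
  by case: eqP => // ij; move: js; rewrite -ij si.
have ajy : 0 < a j y.
  rewrite ltNge; apply/negP => ajy; have := c_le0 y; rewrite leNgt cy => H.
  by suff: false by []; apply: H => i; rewrite inE => /orP[/eqP -> //|]; exact: ay.
pose q x := a j x / a j y.
have qL k x x' : q (k *: x + x') = k * q x + q x' by rewrite /q aL; field; lra.
(* Subtracting a multiple of [y] projects onto the kernel of [a j], where the
   constraint [j] holds for free. *)
pose pr f x : R := f x - q x * f y.
have prE f : (forall k x x', f (k *: x + x') = k * f x + f x') ->
    forall x, pr f x = f (- q x *: y + x) by move=> fL x; rewrite fL /pr; ring.
have prL f : (forall k x x', f (k *: x + x') = k * f x + f x') ->
    forall k x x', pr f (k *: x + x') = k * pr f x + pr f x'.
  by move=> fL k x x'; rewrite /pr fL qL; ring.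
have [||||l [l0 lE]] := IH (pr \o a) (pr c) => //=.
- by move=> i; exact: prL.
- exact: prL.
- move=> x ax; rewrite prE//; apply: c_le0 => i; rewrite inE => /orP[/eqP ->|si].
    by rewrite -prE// /pr /q divfK ?subrr// gt_eqF.
  by rewrite -prE//; exact: ax.
pose lj := (c y - \sum_(i <- s) l i * a i y) / a j y.
exists (fun i => if i == j then lj else l i); split=> [i|x].
  case: ifP => // _; apply: divr_ge0; last exact: ltW.
  rewrite subr_ge0 (le_trans _ (ltW cy))// big_seq; apply: sumr_le0 => k sk.
  by apply: mulr_ge0_le0 => //; exact: ay.
rewrite big_cons eqxx.
have -> : \sum_(i <- s) (if i == j then lj else l i) * a i x =
    \sum_(i <- s) l i * a i x.
  by apply: eq_big_seq => i si; case: eqP => // ij; move: js; rewrite -ij si.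
have := lE x; rewrite {1}/pr /=.
rewrite (eq_bigr (fun i => l i * a i x - q x * (l i * a i y))); last first.
  by move=> i _; rewrite /pr; ring.
rewrite sumrB -mulr_sumr => /eqP; rewrite subr_eq => /eqP ->.
by rewrite /lj /q; field; lra.
Qed.

Lemma finite_pos_lower_bound (R : realFieldType) (T : finType) (P : pred T)
    (f : T -> R) :
  (forall x, P x -> 0 < f x) ->
  exists e : R, 0 < e <= 1 /\ forall x, P x -> e <= f x.
Proof.
move=> f0; exists (\big[Num.min/1]_(x | P x) f x); split=> [|x Px].
  by rewrite lt_bigmin//= bigmin_le_id.
exact: bigmin_le_cond.
Qed.

(** * The bilinear form of A and the l1 norm *)

Definition bil (R : realType) (D : nat) (A : 'M[R]_D) (x y : 'cV[R]_D) : R :=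
  dotp (A *m x) y.

Definition positive (R : realType) (D : nat) (A : 'M[R]_D) : Prop :=
  forall x : 'cV[R]_D, x != 0 -> 0 < bil A x x.

Lemma bilDr (R : realType) (D : nat) (A : 'M[R]_D) x y z :
  bil A x (y + z) = bil A x y + bil A x z.
Proof. exact: dotpDr. Qed.

Lemma bilZr (R : realType) (D : nat) (A : 'M[R]_D) x (k : R) y :
  bil A x (k *: y) = k * bil A x y.
Proof. exact: dotpZr. Qed.

Lemma dotpC (R : realType) (D : nat) (x y : 'cV[R]_D) : dotp x y = dotp y x.
Proof. by apply: eq_bigr => i _; rewrite mulrC. Qed.

Lemma bilDl (R : realType) (D : nat) (A : 'M[R]_D) x y z :
  bil A (x + y) z = bil A x z + bil A y z.
Proof. by rewrite /bil mulmxDr !(dotpC _ z) dotpDr. Qed.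

Lemma bilZl (R : realType) (D : nat) (A : 'M[R]_D) x (k : R) y :
  bil A (k *: x) y = k * bil A x y.
Proof. by rewrite /bil -scalemxAr !(dotpC _ y) dotpZr. Qed.

Lemma bil0l (R : realType) (D : nat) (A : 'M[R]_D) y : bil A 0 y = 0.
Proof. by rewrite -(scale0r 0) bilZl mul0r. Qed.

Lemma bil0r (R : realType) (D : nat) (A : 'M[R]_D) x : bil A x 0 = 0.
Proof. by rewrite -(scale0r 0) bilZr mul0r. Qed.

Lemma bil_suml (R : realType) (D : nat) (A : 'M[R]_D) (I : Type) (r : seq I)
    (P : pred I) (k : I -> R) (x : I -> 'cV[R]_D) y :
  bil A (\sum_(i <- r | P i) k i *: x i) y =
  \sum_(i <- r | P i) k i * bil A (x i) y.
Proof.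
by elim/big_rec2: _ => [|i s v _ <-]; rewrite ?bil0l// bilDl bilZl.
Qed.

Lemma bil_sumr (R : realType) (D : nat) (A : 'M[R]_D) (I : Type) (r : seq I)
    (P : pred I) (k : I -> R) x (y : I -> 'cV[R]_D) :
  bil A x (\sum_(i <- r | P i) k i *: y i) =
  \sum_(i <- r | P i) k i * bil A x (y i).
Proof.
by elim/big_rec2: _ => [|i s v _ <-]; rewrite ?bil0r// bilDr bilZr.
Qed.

Lemma positive_eq0 (R : realType) (D : nat) (A : 'M[R]_D) x :
  positive A -> bil A x x <= 0 -> x = 0.
Proof.
move=> Apos; have [//|/Apos x_gt0] := eqVneq x 0.
by move=> /(lt_le_trans x_gt0); rewrite ltxx.
Qed.

(** The Euclidean norm enters only through its equivalence with this norm,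
    whose triangle inequality is immediate. *)
Definition l1norm (R : realType) (D : nat) (x : 'cV[R]_D) : R :=
  \sum_i `|x i ord0|.

Lemma l1norm_ge0 (R : realType) (D : nat) (x : 'cV[R]_D) : 0 <= l1norm x.
Proof. exact: sumr_ge0. Qed.

Lemma coord_le_l1norm (R : realType) (D : nat) (x : 'cV[R]_D) i :
  `|x i ord0| <= l1norm x.
Proof. by rewrite /l1norm (bigD1 i)//= lerDl sumr_ge0. Qed.

Lemma l1normD (R : realType) (D : nat) (x y : 'cV[R]_D) :
  l1norm (x + y) <= l1norm x + l1norm y.
Proof.
by rewrite -big_split; apply: ler_sum => i _; rewrite mxE ler_normD.
Qed.

Lemma l1normZ (R : realType) (D : nat) (k : R) (x : 'cV[R]_D) :
  l1norm (k *: x) = `|k| * l1norm x.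
Proof.
by rewrite /l1norm mulr_sumr; apply: eq_bigr => i _; rewrite mxE normrM.
Qed.

Lemma enorm_le_l1norm (R : realType) (D : nat) (x : 'cV[R]_D) :
  enorm x <= l1norm x.
Proof.
rewrite /enorm -(ger0_norm (l1norm_ge0 x)) -sqrtr_sqr ler_wsqrtr//.
rewrite expr2 {1}/l1norm mulr_suml; apply: ler_sum => i _.
rewrite -[leLHS]ger0_norm -?expr2 ?sqr_ge0// normrX expr2.
by rewrite ler_wpM2l// coord_le_l1norm.
Qed.

Lemma l1norm_le_enorm (R : realType) (D : nat) (x : 'cV[R]_D) :
  l1norm x <= D%:R * enorm x.
Proof.
have -> : D%:R * enorm x = \sum_(i < D) enorm x.
  by rewrite sumr_const card_ord mulr_natl.
apply: ler_sum => i _.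
rewrite /enorm -sqrtr_sqr ler_wsqrtr// /dotp (bigD1 i)//= expr2 lerDl.
by apply: sumr_ge0 => j _; rewrite -expr2 sqr_ge0.
Qed.

Lemma l1norm_mulmx (R : realType) (D n : nat) (X : 'M[R]_(D, n)) (y : 'cV[R]_n)
    (r : R) :
  (forall i, `|y i ord0| <= r) ->
  l1norm (X *m y) <= (\sum_i \sum_j `|X i j|) * r.
Proof.
move=> yr; rewrite mulr_suml; apply: ler_sum => i _.
rewrite mxE (le_trans (ler_norm_sum _ _ _))// mulr_suml; apply: ler_sum => j _.
by rewrite normrM ler_wpM2l.
Qed.

Lemma bil_bound (R : realType) (D : nat) (A : 'M[R]_D) (x y : 'cV[R]_D) :
  `|bil A x y| <= (\sum_i \sum_j `|A i j|) * l1norm x * l1norm y.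
Proof.
rewrite /bil /dotp (le_trans (ler_norm_sum _ _ _))//.
apply: (@le_trans _ _ (l1norm (A *m x) * l1norm y)).
  rewrite {1}/l1norm mulr_suml; apply: ler_sum => i _.
  by rewrite normrM ler_wpM2l// coord_le_l1norm.
apply: ler_wpM2r; first exact: l1norm_ge0.
by apply: l1norm_mulmx => i; exact: coord_le_l1norm.
Qed.

(** * Balanced vertices *)

(** For p the vertices of a polytope containing 0, these are the vertices of
    the smallest face containing 0. *)
Definition balanced (R : realType) (D n : nat) (p : 'I_n -> 'cV[R]_D)
    (i : 'I_n) : Prop :=
  exists mu : 'I_n -> R,
    [/\ forall j, 0 <= mu j, 0 < mu i & \sum_j mu j *: p j = 0].

(** In a vanishing nonnegative combination, a large value of [dotp a (p i)]
    has to be compensated by a very negative value at another index. *)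
Lemma balanced_bound (R : realType) (D n : nat) (p : 'I_n -> 'cV[R]_D) :
  exists C : R, 0 <= C /\ forall (a : 'cV[R]_D) (t : R), 0 <= t ->
    (forall j, - dotp a (p j) <= t) ->
    forall i, balanced p i -> `|dotp a (p i)| <= C * t.
Proof.
have CP i : exists C : R, 0 <= C /\ forall (a : 'cV[R]_D) (t : R), 0 <= t ->
    (forall j, - dotp a (p j) <= t) ->
    balanced p i -> `|dotp a (p i)| <= C * t.
  have [[mu [mu0 mui mup]]|nb] := pselect (balanced p i); last by exists 0.
  pose S := \sum_j mu j.
  have Si : mu i <= S by rewrite /S (bigD1 i)//= lerDl sumr_ge0.
  exists (S / mu i); split=> [|a t t0 at_ _].
    by rewrite divr_ge0 ?(ltW mui)// (le_trans _ Si)// ltW.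
  have S1 : t <= S / mu i * t.
    by rewrite ler_peMl// ler_pdivlMr// mul1r.
  rewrite ler_norml; apply/andP; split; first by have := at_ i; lra.
  have : dotp a (\sum_j mu j *: p j) = 0.
    by rewrite mup -(scale0r 0) dotpZr mul0r.
  have -> : dotp a (\sum_j mu j *: p j) = \sum_j mu j * dotp a (p j).
    elim/big_rec2: _ => [|j u v _ <-]; last by rewrite dotpDr dotpZr.
    by rewrite -(scale0r 0) dotpZr mul0r.
  rewrite (bigD1 i)//= => sum0.
  rewrite mulrAC ler_pdivlMr// mulrC.
  have -> : mu i * dotp a (p i) = \sum_(j | j != i) mu j * - dotp a (p j).
    by under eq_bigr do rewrite mulrN; rewrite sumrN; lra.
  rewrite mulr_suml [leRHS](bigD1 i)//= -[leLHS]add0r lerD//.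
    by rewrite mulr_ge0// ltW.
  by apply: ler_sum => j _; rewrite ler_wpM2l.
have /choice[C CP'] := CP.
exists (\sum_i C i); split=> [|a t t0 at_ i ib].
  by apply: sumr_ge0 => i _; exact: (CP' i).1.
apply: (le_trans ((CP' i).2 a t t0 at_ ib)); rewrite ler_wpM2r//.
by rewrite (bigD1 i)//= lerDl sumr_ge0// => j _; exact: (CP' j).1.
Qed.

(** The Gram matrix G = W^T A W has the same kernel as W, because G c = 0
    gives b(W c, W c) = 0. Hence W = X G for some X, and W c is recovered from
    the pairings (G c)_i = b(W c, W_i). *)
Lemma span_bound (R : realType) (D n : nat) (A : 'M[R]_D) (W : 'M[R]_(D, n)) :
  positive A ->
  exists C : R, 0 <= C /\ forall (c : 'cV[R]_n) (r : R),
    (forall i, `|bil A (W *m c) (col i W)| <= r) -> l1norm (W *m c) <= C * r.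
Proof.
move=> Apos.
pose G := W^T *m (A *m W).
have GE (c : 'cV[R]_n) i : (G *m c) i ord0 = bil A (W *m c) (col i W).
  rewrite /G -!mulmxA mxE /bil dotpC; apply: eq_bigr => j _.
  by rewrite !mxE.
have /submxP[X WX] : (W <= G)%MS.
  rewrite submxE; apply/eqP/matrixP => i j; rewrite [RHS]mxE.
  pose c := col j (cokermx G).
  have Gc : G *m c = 0 by rewrite /c colE mulmxA mulmx_coker mul0mx.
  suff Wc : W *m c = 0.
    have := congr1 (fun u : 'cV[R]_D => u i ord0) Wc.
    by rewrite /c colE mulmxA -colE mxE [in RHS]mxE.
  apply: (positive_eq0 Apos).
  rewrite {2}(_ : W *m c = \sum_i c i ord0 *: col i W); last first.
    apply/matrixP => k k'; rewrite ord1 mxE summxE; apply: eq_bigr => u _.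
    by rewrite !mxE mulrC.
  by rewrite bil_sumr big1// => k _; rewrite -GE Gc [X in _ * X]mxE mulr0.
exists (\sum_i \sum_j `|X i j|); split.
  by apply: sumr_ge0 => i _; exact: sumr_ge0.
move=> c r cr; rewrite {1}WX -mulmxA; apply: l1norm_mulmx => i.
by rewrite GE.
Qed.

(** * Descent directions for a set of vertices *)

(** The conditions form a homogeneous linear system in the weights, and by
    summing solutions it suffices to make one strict inequality hold at a time.
    If one cannot hold, Farkas' lemma yields a vanishing nonnegative combination
    of all conditions in which that one has a positive multiplier. Let mu be the
    multipliers of the conditions on b and v = sum_j mu_j p_j; then
    b(v, x) <= 0 for every nonnegative combination x of F, and x = v gives
    v = 0. Hence the multipliers of the conditions l_i >= 0 vanish, so the
    offending condition is one on b, and v = 0 exhibits its index as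
    balanced. *)
Lemma positive_weights (R : realType) (D n : nat) (A : 'M[R]_D)
    (p : 'I_n -> 'cV[R]_D) (F : {set 'I_n}) :
  positive A ->
  exists l : 'I_n -> R, let v := \sum_(j in F) l j *: p j in
    [/\ forall i, i \in F -> 0 < l i,
        forall i, i \in F -> 0 <= bil A (p i) v
      & forall i, i \in F -> ~ balanced p i -> 0 < bil A (p i) v].
Proof.
move=> Apos.
pose comb (x : 'cV[R]_n) := \sum_(j in F) x j ord0 *: p j.
have combL k x y : comb (k *: x + y) = k *: comb x + comb y.
  rewrite /comb scaler_sumr -big_split; apply: eq_bigr => j _ /=.
  by rewrite !mxE scalerDl scalerA.
pose a (t : bool * 'I_n) (x : 'cV[R]_n) : R :=
  if t.1 then - x t.2 ord0 else - bil A (p t.2) (comb x).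
have aL t k x y : a t (k *: x + y) = k * a t x + a t y.
  rewrite /a; case: t.1; first by rewrite !mxE; ring.
  by rewrite combL bilDr bilZr; ring.
pose s : seq (bool * 'I_n) :=
  [seq (true, i) | i <- enum F] ++ [seq (false, i) | i <- enum F].
have sE b i : ((b, i) \in s) = (i \in F).
  have inj (c : bool) : injective (pair c : 'I_n -> bool * 'I_n).
    by move=> ? ? [].
  have no c : ((~~ c, i) \in [seq (c, i) | i <- enum F]) = false.
    by apply/negP => /mapP[? _ []]; case: c.
  rewrite mem_cat; case: b.
    by rewrite (no false) orbF (mem_map (inj _)) mem_enum.
  by rewrite (no true) /= (mem_map (inj _)) mem_enum.
have s_uniq : uniq s.
  rewrite cat_uniq !map_inj_uniq ?enum_uniq ?andbT//=; try by move=> ? ? [].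
  by apply/hasPn => _ /mapP[i _ ->]; apply/negP => /mapP[? _ []].
have sumE (h : bool * 'I_n -> R) : \sum_(t <- s) h t =
    \sum_(i in F) h (true, i) + \sum_(i in F) h (false, i).
  by rewrite big_cat !big_map !big_enum.
have strict t : exists x, (forall r, r \in s -> a r x <= 0) /\
    (t \in s -> t.1 \/ ~ balanced p t.2 -> a t x < 0).
  have [ts|ts] := boolP (t \in s); last first.
    exists 0; split=> // r _; have := aL r 1 0 0.
    by rewrite scaler0 addr0; lra.
  have [nt|tT] := pselect (~ (t.1 \/ ~ balanced p t.2)).
    exists 0; split=> // r _; have := aL r 1 0 0.
    by rewrite scaler0 addr0; lra.
  apply: contrapT => nox.
  have [|||l [l0 lE]] := @farkas R _ _ s a (fun x => - a t x) aL => //.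
  - by move=> k x y; rewrite aL; ring.
  - move=> x ax; rewrite leNgt oppr_gt0; apply/negP => atx.
    by apply: nox; exists x.
  pose l' r := l r + (r == t)%:R.
  have l'0 r : 0 <= l' r by apply: addr_ge0 => //; exact: ler0n.
  have l't : 0 < l' t by rewrite /l' eqxx ltr_pwDr.
  have l'E x : \sum_(r <- s) l' r * a r x = 0.
    rewrite (eq_bigr (fun r => l r * a r x + (r == t)%:R * a r x)); last first.
      by move=> r _; rewrite mulrDl.
    rewrite big_split -lE /= (big_rem t)//= eqxx big_seq big1 ?addr0.
      by rewrite mul1r; ring.
    move=> r; rewrite mem_rem_uniq// inE => /andP[/negPf ->].
    by rewrite mul0r.
  pose mu : 'cV[R]_n := \col_i (if i \in F then l' (false, i) else 0).
  pose v := comb mu.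
  have combE x : bil A v (comb x) = - \sum_(i in F) l' (true, i) * x i ord0.
    have := l'E x; rewrite sumE /a /= => /eqP; rewrite addr_eq0 => /eqP.
    rewrite (eq_bigr (fun i => - (l' (true, i) * x i ord0))); last first.
      by move=> i _; rewrite mulrN.
    rewrite sumrN => ->; rewrite bil_suml -sumrN; apply: eq_bigr => i iF.
    by rewrite mxE iF; ring.
  have v0 : v = 0.
    apply: (positive_eq0 Apos); rewrite combE oppr_le0; apply: sumr_ge0 => i iF.
    by rewrite mxE iF mulr_ge0.
  case: t ts {nox lE} tT @l' l'0 l't l'E @mu @v combE v0 => [[] i].
    rewrite sE => iF _ l' l'0 l't _ mu v combE v0.
    have := combE (delta_mx i ord0); rewrite v0 bil0l (bigD1 i)//= big1.
      by rewrite mxE !eqxx addr0 mulr1; move: l't; lra.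
    by move=> j /andP[_ /negPf ji]; rewrite mxE ji mulr0.
  rewrite sE => iF /contrapT[//|nbal] l' l'0 l't _ mu v combE v0; apply: nbal.
  exists (fun j => mu j ord0); split.
  - by move=> j; rewrite /= /mu mxE; case: ifP.
  - by rewrite /= /mu mxE iF.
  - rewrite -[RHS]v0 /v /comb [RHS]big_mkcond; apply: eq_bigr => j _ /=.
    by rewrite /mu mxE; case: ifP => // _; rewrite scale0r.
have /choice[X XP] := strict.
pose x := \sum_t X t.
have aE r : a r x = \sum_t a r (X t).
  rewrite /x; elim/big_rec2: _ => [|t y z _ <-].
    by have := aL r 1 0 0; rewrite scaler0 addr0; lra.
  by have := aL r 1 (X t) z; rewrite scale1r mul1r.
have ax r : r \in s -> a r x <= 0.
  by move=> rs; rewrite aE; apply: sumr_le0 => t _; exact: (XP t).1.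
have ax_lt r : r \in s -> r.1 \/ ~ balanced p r.2 -> a r x < 0.
  move=> rs rT; rewrite aE (bigD1 r)//= ltr_wnDr//.
    by apply: sumr_le0 => t _; exact: (XP t).1.
  exact: (XP r).2.
exists (fun j => x j ord0); split=> i iF.
- by have := @ax_lt (true, i); rewrite sE /a /= oppr_lt0; apply=> //; left.
- by have := @ax (false, i); rewrite sE /a /= oppr_le0; apply.
- by move=> nb; have := @ax_lt (false, i); rewrite sE /a /= oppr_lt0; apply=> //; right.
Qed.

Lemma simplex_weights (R : realType) (D n : nat) (A : 'M[R]_D)
    (p : 'I_n -> 'cV[R]_D) (F : {set 'I_n}) :
  positive A ->
  exists l : 'I_n -> R, (0 < #|F|)%N -> let v := \sum_(j in F) l j *: p j in
    [/\ forall i, i \in F -> 0 < l i, \sum_(i in F) l i = 1,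
        forall i, i \in F -> 0 <= bil A (p i) v
      & forall i, i \in F -> ~ balanced p i -> 0 < bil A (p i) v].
Proof.
move=> Apos; have [l [l0 lA lA']] := positive_weights p F Apos.
pose S := \sum_(i in F) l i.
exists (fun i => S^-1 * l i) => F0.
have S0 : 0 < S.
  have /card_gt0P[i iF] := F0; rewrite /S (bigD1 i)//= ltr_pwDl ?l0//.
  by apply: sumr_ge0 => j /andP[jF _]; exact/ltW/l0.
have -> : \sum_(j in F) (S^-1 * l j) *: p j = S^-1 *: \sum_(j in F) l j *: p j.
  by rewrite scaler_sumr; apply: eq_bigr => j _; rewrite scalerA.
split=> [i iF||i iF|i iF nb].
- by rewrite mulr_gt0 ?invr_gt0 ?l0.
- by rewrite -mulr_sumr mulVf// gt_eqF.
- by rewrite bilZr mulr_ge0 ?invr_ge0 ?(ltW S0) ?lA.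
- by rewrite bilZr mulr_gt0 ?invr_gt0 ?lA'.
Qed.

Lemma uniform_weights (R : realType) (D n : nat) (A : 'M[R]_D)
    (p : 'I_n -> 'cV[R]_D) :
  positive A ->
  exists (l : {set 'I_n} -> 'I_n -> R) (eps delta : R),
    let v (F : {set 'I_n}) := \sum_(j in F) l F j *: p j in
    [/\ 0 < eps <= 1, 0 < delta,
        forall F : {set 'I_n}, (0 < #|F|)%N ->
          (forall i, i \in F -> eps <= l F i) /\ \sum_(i in F) l F i = 1,
        forall (F : {set 'I_n}) i, i \in F -> 0 <= bil A (p i) (v F)
      & forall (F : {set 'I_n}) i, i \in F -> ~ balanced p i ->
          delta <= bil A (p i) (v F)].
Proof.
move=> Apos.
have /choice[l lP] : forall F : {set 'I_n}, _ := fun F => simplex_weights p F Apos.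
have pos (F : {set 'I_n}) i : i \in F -> (0 < #|F|)%N.
  by move=> iF; apply/card_gt0P; exists i.
have [|eps [eps01 epsP]] := @finite_pos_lower_bound R _
    (fun t : {set 'I_n} * 'I_n => t.2 \in t.1) (fun t => l t.1 t.2).
  by move=> [F i] /= iF; have [l0 _ _ _] := lP F (pos _ _ iF); exact: l0.
have [|delta [/andP[delta0 _] deltaP]] := @finite_pos_lower_bound R _
    (fun t : {set 'I_n} * 'I_n => (t.2 \in t.1) && `[< ~ balanced p t.2 >])
    (fun t => bil A (p t.2) (\sum_(j in t.1) l t.1 j *: p j)).
  move=> [F i] /= /andP[iF /asboolP nb].
  by have [_ _ _ l3] := lP F (pos _ _ iF); exact: l3.
exists l, eps, delta; split=> // [F F0|F i iF|F i iF nb].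
- by have [_ l1 _ _] := lP F F0; split=> // i iF; exact: (epsP (F, i)).
- by have [_ _ l2 _] := lP F (pos _ _ iF); exact: l2.
- by apply: (deltaP (F, i)); rewrite /= iF; exact/asboolP.
Qed.

(** * The potential *)

(** Let m be the minimum of [a] and N = #|F|. Comparing F with the singleton of
    a minimizer shows that all members of F are within M K^N / eps of m. If i0
    were missing, all members of F + i0 would be that close to m, so passing
    from F to F + i0 would cost at most M K^N / eps in the sum, but gain
    M K^N (K - 1) = M K^N (1 + 1 / eps) in the offset. *)
Lemma maximal_face_near_min (R : realFieldType) (n : nat)
    (l : {set 'I_n} -> 'I_n -> R) (eps M : R) (a : 'I_n -> R)
    (i0 : 'I_n) (F : {set 'I_n}) :
  let g (G : {set 'I_n}) := M * (2 + eps^-1) ^+ #|G| - \sum_(i in G) l G i * a i in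
  0 < eps <= 1 -> 0 < M ->
  (forall G : {set 'I_n}, (0 < #|G|)%N ->
     (forall i, i \in G -> eps <= l G i) /\ \sum_(i in G) l G i = 1) ->
  (forall i, a i0 <= a i + M) ->
  (0 < #|F|)%N -> (forall G : {set 'I_n}, (0 < #|G|)%N -> g G <= g F) ->
  i0 \in F.
Proof.
move=> g /andP[eps0 eps1] M0 lP ai0 F0 gF.
set K := 2 + eps^-1 in g gF.
have K1 : 1 <= K.
  by rewrite /K -[leLHS]addr0 lerD ?ler1n ?invr_ge0 ?(ltW eps0).
have [jm _ jm_min] := @arg_minP _ _ _ i0 predT a isT.
set m := a jm in jm_min.
have Kn0 N : 0 < M * K ^+ N by rewrite mulr_gt0// exprn_gt0// (lt_le_trans _ K1).
have sumB (G : {set 'I_n}) : (0 < #|G|)%N ->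
    \sum_(i in G) l G i * a i = m + \sum_(i in G) l G i * (a i - m).
  move=> G0; rewrite -[in X in X + _](mul1r m) -(lP G G0).2 mulr_suml -big_split.
  by apply: eq_bigr => i _ /=; ring.
pose N := #|F|.
(* Comparing F with the singleton of a minimizer: every member of F is within
   [M K^N / eps] of the minimum. *)
have F_near i : i \in F -> a i - m <= M * K ^+ N / eps.
  move=> iF; rewrite ler_pdivlMr// mulrC.
  apply: (@le_trans _ _ (l F i * (a i - m))).
    by rewrite ler_wpM2r ?(lP F F0).1// subr_ge0 jm_min.
  apply: (@le_trans _ _ (\sum_(j in F) l F j * (a j - m))).
    rewrite (bigD1 i)//= lerDl; apply: sumr_ge0 => j /andP[jF _].
    rewrite mulr_ge0 ?subr_ge0 ?jm_min//.
    exact: le_trans (ltW eps0) ((lP F F0).1 _ jF).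
  have j0 : (0 < #|[set jm]%SET|)%N by rewrite cards1.
  have := gF [set jm]%SET j0; rewrite /g !sumB// big_set1 cards1 subrr mulr0.
  by have := Kn0 1%N; rewrite -/N; lra.
apply: contraT => i0F.
have G0 : (0 < #|i0 |: F|)%N by rewrite cardsU1 i0F.
have sumG : \sum_(i in i0 |: F) l (i0 |: F) i * (a i - m) <= M * K ^+ N / eps.
  rewrite -[leRHS]mul1r -(lP _ G0).2 mulr_suml; apply: ler_sum => i iG.
  apply: ler_wpM2l; first exact: le_trans (ltW eps0) ((lP _ G0).1 _ iG).
  move: iG; rewrite in_setU1 => /orP[/eqP ->|]; last exact: F_near.
  apply: (@le_trans _ _ M); first by have := ai0 jm; rewrite -/m; lra.
  rewrite -mulrA ler_peMr ?(ltW M0)// -[leLHS]mulr1 ler_pM//.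
    exact: exprn_ege1.
  by rewrite invf_ge1.
have sumF : 0 <= \sum_(i in F) l F i * (a i - m).
  apply: sumr_ge0 => j jF; rewrite mulr_ge0 ?subr_ge0 ?jm_min//.
  exact: le_trans (ltW eps0) ((lP F F0).1 _ jF).
have := gF _ G0; rewrite /g !sumB// cardsU1 i0F /= add1n exprS -/N.
have -> : M * (K * K ^+ N) = M * K ^+ N *+ 2 + M * K ^+ N / eps.
  by rewrite /K; ring.
have := Kn0 N; move: sumG sumF; rewrite mulr2n; lra.
Qed.

Definition potential (R : realType) (D n : nat) (A : 'M[R]_D)
    (p : 'I_n -> 'cV[R]_D) (l : {set 'I_n} -> 'I_n -> R) (M K : R)
    (F : {set 'I_n}) (z : 'cV[R]_D) : R :=
  M * K ^+ #|F| - bil A z (\sum_(j in F) l F j *: p j).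

(** The set F attaining the maximum after the update contains i0, because an
    update moves each value b(z, p_j) by at most wbar C0, so that i0 is still
    within B + 2 wbar C0 of the minimum. The F-term was at most t before and has
    dropped by w b(p_i0, v_F). *)
Lemma potential_step (R : realType) (D n : nat) (A : 'M[R]_D)
    (p : 'I_n -> 'cV[R]_D) (l : {set 'I_n} -> 'I_n -> R)
    (eps M B C0 wbar w d t : R) (z : 'cV[R]_D) (i0 : 'I_n) :
  let phi := potential A p l M (2 + eps^-1) in
  0 < eps <= 1 -> 0 < M -> B + 2 * (wbar * C0) <= M ->
  (forall G : {set 'I_n}, (0 < #|G|)%N ->
     (forall i, i \in G -> eps <= l G i) /\ \sum_(i in G) l G i = 1) ->
  (forall i j, `|bil A (p i) (p j)| <= C0) ->
  0 <= w <= wbar ->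
  (forall j, bil A z (p i0) <= bil A z (p j) + B) ->
  (forall F : {set 'I_n}, i0 \in F ->
     d <= bil A (p i0) (\sum_(j in F) l F j *: p j)) ->
  (forall F : {set 'I_n}, (0 < #|F|)%N -> phi F z <= t) ->
  forall F : {set 'I_n}, (0 < #|F|)%N -> phi F (z + w *: p i0) <= t - w * d.
Proof.
move=> phi eps01 M0 MB lP C0P /andP[w0 wle] near dP phi_t F1 F10.
set z' := z + w *: p i0.
have [F F0 Fmax] := @arg_maxP _ _ _ F1 (fun G : {set 'I_n} => (0 < #|G|)%N)
  (fun G => phi G z') F10.
apply: (le_trans (Fmax _ F10)).
have bz' j : bil A z' (p j) = bil A z (p j) + w * bil A (p i0) (p j).
  by rewrite bilDl bilZl.
have wC j : `|w * bil A (p i0) (p j)| <= wbar * C0.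
  by rewrite normrM ger0_norm// ler_pM.
have i0F : i0 \in F.
  apply: (@maximal_face_near_min _ _ l eps M (fun j => bil A z' (p j))) => //.
    move=> j; rewrite !bz'; have := near j; have := wC j; have := wC i0.
    by rewrite !ler_norml => /andP[? ?] /andP[? ?]; lra.
  move=> G G0; have := Fmax G G0; rewrite /phi /potential !bil_sumr.
  by [].
rewrite /phi /potential bilDl bilZl.
have := phi_t F F0; rewrite /phi /potential.
by have := ler_wpM2l w0 (dP F i0F); lra.
Qed.

(** * Boundedness of weighted updates *)

(** The last condition encodes that the minimum over the polytope is at most 0.
    Stating it for the selected point makes it a direct consequence of 0 being
    in the polytope, without writing 0 as a convex combination of vertices. *)
Definition near_greedy (R : realType) (D n : nat) (A : 'M[R]_D)
    (p : 'I_n -> 'cV[R]_D) (wbar B : R) (z : nat -> 'cV[R]_D)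
    (i : nat -> 'I_n) (w : nat -> R) : Prop :=
  forall k, [/\ z k.+1 = z k + w k *: p (i k), 0 <= w k <= wbar,
    forall j, bil A (z k) (p (i k)) <= bil A (z k) (p j) + B
    & bil A (z k) (p (i k)) <= B].

(** The invariant splits [z m] as W c + y, where W c collects the updates along
    balanced vertices and y the initial point and all other updates, whose total
    weight S is charged to the potential. *)
Lemma near_greedy_bounded (R : realType) (D n : nat) (A : 'M[R]_D)
    (p : 'I_n -> 'cV[R]_D) :
  positive A ->
  exists C : R, 1 <= C /\ forall wbar B z i w, 0 <= wbar -> 0 <= B ->
    near_greedy A p wbar B z i w ->
    forall k, l1norm (z k) <= C * (wbar + l1norm (z 0%N) + B).
Proof.
move=> Apos.
have [l [eps [delta [eps01 delta0 lP l_ge0 l_gt0]]]] := uniform_weights p Apos.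
have [Cb [Cb0 CbP]] := balanced_bound p.
pose W : 'M[R]_(D, n) :=
  \matrix_(r, j) (if `[< balanced p j >] then p j r ord0 else 0).
have colW j : col j W = if `[< balanced p j >] then p j else 0.
  by apply/matrixP => r s; rewrite (ord1 s) !mxE; case: ifP; rewrite ?mxE.
have [Cs [Cs0 CsP]] := span_bound W Apos.
(* [NA] bounds the form and [P] the points; [ct], [cy] and [cx] will bound the
   initial potential, y and W c relative to wbar + |z 0| + B. *)
pose NA : R := \sum_i \sum_j `|A i j|.
have NA0 : 0 <= NA by apply: sumr_ge0 => i _; exact: sumr_ge0.
pose P := \sum_j l1norm (p j).
have P0 : 0 <= P by apply: sumr_ge0 => j _; exact: l1norm_ge0.
have pP j : l1norm (p j) <= P.
  by rewrite /P (bigD1 j)//= lerDl; apply: sumr_ge0 => *; exact: l1norm_ge0.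
have bilP x y r : l1norm y <= r -> `|bil A x y| <= NA * r * l1norm x.
  move=> yr; apply: (le_trans (bil_bound _ _ _)).
  by rewrite mulrAC ler_wpM2r ?l1norm_ge0// ler_wpM2l.
pose C0 : R := NA * P * P + 1.
have C01 : 1 <= C0 by rewrite /C0 lerDr !mulr_ge0.
have C0P j j' : `|bil A (p j) (p j')| <= C0.
  apply: (le_trans (bilP _ _ _ (pP j'))); rewrite /C0.
  by apply: (@le_trans _ _ (NA * P * P)); rewrite ?lerDl// ler_wpM2l ?mulr_ge0.
have vP (F : {set 'I_n}) : (0 < #|F|)%N -> l1norm (\sum_(j in F) l F j *: p j) <= P.
  move=> F0; have [l0 l1] := lP F F0.
  apply: (@le_trans _ _ (\sum_(j in F) l F j * P)); last by rewrite -mulr_suml l1 mul1r.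
  have {}l0 j : j \in F -> 0 <= l F j.
    by move=> jF; apply: le_trans (l0 _ jF); case/andP: eps01 => /ltW.
  elim/big_rec2: _ => [|j u v jF uv].
    by rewrite /l1norm big1// => j _; rewrite mxE normr0.
  rewrite (le_trans (l1normD _ _))// lerD// l1normZ ger0_norm ?l0//.
  by rewrite ler_wpM2l ?l0.
pose K := 2 + eps^-1.
have K1 : 1 <= K.
  by rewrite /K -[leLHS]addr0 lerD ?ler1n ?invr_ge0//; case/andP: eps01 => /ltW.
pose ct := NA * P + 2 * C0 * K ^+ n.
have Kn0 : 0 <= K ^+ n by rewrite exprn_ge0// (le_trans _ K1).
have ct0 : 0 <= ct by rewrite /ct addr_ge0 ?mulr_ge0// (le_trans _ C01).
pose cy := 1 + P * (ct / delta).
have cy0 : 0 <= cy by rewrite /cy addr_ge0 ?mulr_ge0// invr_ge0 ltW.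
pose cx := Cs * (Cb * ct + NA * P * cy).
have cx0 : 0 <= cx by rewrite /cx mulr_ge0 ?addr_ge0 ?mulr_ge0.
exists (1 + cy + cx); split; first by rewrite -addrA lerDl addr_ge0.
move=> wbar B z i w wbar0 B0 zP k.
pose T := wbar + l1norm (z 0%N) + B.
have z0T : l1norm (z 0%N) <= T by rewrite /T; lra.
have T0 : 0 <= T by apply: le_trans z0T; exact: l1norm_ge0.
(* The offsets of the potential must be positive, which [wbar > 0] ensures; for
   [wbar = 0] the points do not move. *)
have [wbar_eq0|wbar_gt0] : wbar = 0 \/ 0 < wbar.
  by move: wbar0; rewrite le_eqVlt => /orP[/eqP <-|]; [left|right].
  have -> : z k = z 0%N.
    elim: k => // k IH; have [-> wk _ _] := zP k.
    have -> : w k = 0 by apply/eqP; rewrite eq_le -{1}wbar_eq0 andbC.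
    by rewrite scale0r addr0.
  by apply: (le_trans z0T); rewrite -/T ler_peMl// -addrA lerDl addr_ge0.
pose M := B + 2 * (wbar * C0).
have M0 : 0 < M by rewrite /M ltr_wpDl// !mulr_gt0// (lt_le_trans _ C01).
have MT : M <= 2 * C0 * T.
  have B1 : B <= 2 * C0 * B by rewrite ler_peMl//; lra.
  have l1 : 0 <= 2 * C0 * l1norm (z 0%N).
    by rewrite !mulr_ge0 ?l1norm_ge0// (le_trans _ C01).
  rewrite /M /T; have -> : 2 * C0 * (wbar + l1norm (z 0%N) + B) =
    2 * (wbar * C0) + 2 * C0 * l1norm (z 0%N) + 2 * C0 * B by ring.
  lra.
pose phi := potential A p l M K.
pose t0 := NA * P * l1norm (z 0%N) + M * K ^+ n.
have t0T : t0 <= ct * T.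
  rewrite /t0 /ct [leRHS]mulrDl; apply: lerD; first by rewrite ler_wpM2l// mulr_ge0.
  by rewrite [leRHS]mulrAC ler_wpM2r.
have invariant m : exists (c : 'cV[R]_n) (y : 'cV[R]_D) (S : R),
    [/\ z m = W *m c + y, 0 <= S, l1norm y <= l1norm (z 0%N) + P * S
      & forall F : {set 'I_n}, (0 < #|F|)%N -> phi F (z m) <= t0 - delta * S].
  elim: m => [|m [c [y [S [zE S0 yS phiS]]]]].
    exists 0, (z 0%N), 0; rewrite mulmx0 add0r mulr0 addr0; split=> // F F0.
    rewrite mulr0 subr0 /phi /potential /t0 [leLHS]addrC; apply: lerD.
      rewrite lerNl; have := bilP (z 0%N) _ _ (vP F F0).
      by rewrite ler_norml => /andP[].
    rewrite ler_pM2l// ler_weXn2l//.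
    by rewrite -[leqRHS]card_ord max_card.
  have [zS wm near _] := zP m.
  have w0 : 0 <= w m by case/andP: wm.
  have [bal|nbal] := pselect (balanced p (i m)).
    exists (c + w m *: delta_mx (i m) ord0), y, S; split=> //.
      rewrite zS zE mulmxDr -scalemxAr -colE colW ifT; last exact/asboolP.
      by rewrite addrAC.
    rewrite zS -[t0 - _]subr0 -[X in _ - X](mulr0 (w m)).
    apply: (potential_step eps01 M0 (lexx _) lP C0P wm near) => // G.
    exact: l_ge0.
  exists c, (y + w m *: p (i m)), (S + w m); split.
  - by rewrite zS zE addrA.
  - exact: addr_ge0.
  - rewrite (le_trans (l1normD _ _))// l1normZ ger0_norm//.
    rewrite mulrDr addrA lerD// mulrC ler_wpM2r//.
  - rewrite zS (_ : t0 - delta * (S + w m) = t0 - delta * S - w m * delta); last ring.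
    apply: (potential_step eps01 M0 (lexx _) lP C0P wm near) => // G iG.
    exact: l_gt0.
have [c [y [S [zE S0 yS phiS]]]] := invariant k.
(* The terms of the singletons bound each form value from below. *)
have single j : M * K - bil A (z k) (p j) <= t0 - delta * S.
  have := phiS [set j]%SET; rewrite cards1 => /(_ isT).
  rewrite /phi /potential cards1 big_set1 expr1.
  have [|_] := lP [set j]%SET; first by rewrite cards1.
  by rewrite big_set1 => ->; rewrite scale1r.
have MK : B <= M * K.
  apply: (@le_trans _ _ M); last by rewrite ler_peMr// ltW.
  by rewrite /M lerDl !mulr_ge0// (le_trans _ C01).
have dS : delta * S <= t0.
  by have [_ _ _ last] := zP k; have := single (i k); lra.
have t00 : 0 <= t0 by apply: le_trans dS; rewrite mulr_ge0// ltW.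
have yT : l1norm y <= cy * T.
  apply: (le_trans yS); rewrite /cy mulrDl mul1r lerD// -mulrA ler_wpM2l//.
  by rewrite mulrAC ler_pdivlMr// mulrC (le_trans dS).
have balT j : balanced p j -> `|bil A (z k) (p j)| <= Cb * ct * T.
  move=> bj; rewrite -mulrA; apply: (@le_trans _ _ (Cb * t0)); last by rewrite ler_wpM2l.
  apply: CbP => // j'; have := single j'; rewrite /bil.
  have : 0 <= delta * S by rewrite mulr_ge0// ltW.
  by lra.
have xT : l1norm (W *m c) <= cx * T.
  rewrite /cx -mulrA; apply: CsP => j; rewrite colW.
  case: asboolP => bj; last first.
    by rewrite bil0r normr0; apply: mulr_ge0 => //; rewrite addr_ge0 ?mulr_ge0.
  have -> : bil A (W *m c) (p j) = bil A (z k) (p j) - bil A y (p j).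
    by rewrite zE bilDl addrK.
  rewrite (le_trans (ler_normB _ _))// mulrDl lerD ?balT//.
  apply: (le_trans (bilP y _ _ (pP j))).
  by rewrite -[leRHS]mulrA ler_wpM2l// mulr_ge0.
have := l1normD (W *m c) y; rewrite -zE -/T.
have -> : (1 + cy + cx) * T = T + cy * T + cx * T by ring.
by move: T0 xT yT; lra.
Qed.

(** * Polytopes and their vertices *)

Lemma vert_conv_hull_sub (R : realType) (D : nat) (S : set 'cV[R]_D) :
  vert (conv_hull S) `<=` S.
Proof.
move=> v [Vv vext]; apply: contrapT => vS.
(* An extreme point can be removed from a convex set. *)
have : (conv_hull S `\ v) v; last by case=> _ /(_ erefl).
have hullS : S `<=` conv_hull S by move=> x Sx C [_ SC]; exact: SC.
apply: Vv; split; last first.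
  by move=> x Sx; split; [exact: hullS|move=> xv; apply: vS; rewrite -xv].
apply/convex_setW => x y; rewrite !inE => -[Vx xv] [Vy yv] t t0 t1.
rewrite inE; split.
  move=> C [Cconv SC]; have := Cconv x y t.
  by rewrite !inE; apply; [exact: Vx|exact: Vy].
move=> xyv; have [] := vext x y t%:num Vx Vy; rewrite ?t0 ?t1//.
Qed.

Lemma polytope_minval_le (R : realType) (D : nat) (V : set 'cV[R]_D)
    (a v : 'cV[R]_D) : polytope V -> V v -> minval V (dotp a) <= dotp a v.
Proof. by move=> /(polytope_minE a)[u [_ u_min] ->] Vv; exact: u_min. Qed.

Lemma posdef_positive (R : realType) (D : nat) (A : 'M[R]_D) :
  posdefmx (2^-1 *: (A + A^T)) -> positive A.
Proof.
move=> [_ Apos] x /Apos.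
have -> : dotp (2^-1 *: (A + A^T) *m x) x =
    2^-1 * (bil A x x + dotp (A^T *m x) x).
  by rewrite -scalemxAl mulmxDl /bil !(dotpC _ x) dotpZr dotpDr.
have -> : dotp (A^T *m x) x = bil A x x.
  have dotpE u v : dotp u v = (u^T *m v) ord0 ord0 :> R.
    by rewrite mxE; apply: eq_bigr => j _; rewrite mxE.
  by rewrite /bil [RHS]dotpC !dotpE trmx_mul trmxK mulmxA.
lra.
Qed.

(** Finiteness and positivity are premises inside the
    existential, so that a constant can be chosen for every pair of a set and a
    matrix. *)
Lemma finite_near_greedy_bounded (R : realType) (D : nat)
    (UA : set 'cV[R]_D * 'M[R]_D) :
  exists C : R, 1 <= C /\ (finite_set UA.1 -> positive UA.2 ->
    forall wbar B (z u : nat -> 'cV[R]_D) (w : nat -> R),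
    0 <= wbar -> 0 <= B ->
    (forall k, [/\ z k.+1 = z k + w k *: u k, 0 <= w k <= wbar, UA.1 (u k),
       forall v, UA.1 v -> bil UA.2 (z k) (u k) <= bil UA.2 (z k) v + B
       & bil UA.2 (z k) (u k) <= B]) ->
    forall k, enorm (z k) <= C * (wbar + enorm (z 0%N) + B)).
Proof.
case: UA => U A /=.
have [Apos|nA] := pselect (positive A); last by exists 1.
have [/finite_seqP[s UE]|nU] := pselect (finite_set U); last by exists 1.
pose p (i : 'I_(size s)) := tnth (in_tuple s) i.
have [C [C1 CP]] := near_greedy_bounded p Apos.
exists (C * D.+1%:R); split.
  by rewrite -[leLHS]mulr1 ler_pM// ler1n.
move=> _ _ wbar B z u w wbar0 B0 zP k.
have /choice[i iP] : forall k, exists i, u k = p i.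
  move=> m; have [_ _ + _ _] := zP m; rewrite UE /= => us; exact/(tnthP (in_tuple s)).
have zP' : near_greedy A p wbar B z i w.
  move=> m; have [zS wm _ near uB] := zP m; rewrite -iP; split=> // j.
  by apply: near; rewrite UE /= mem_tnth.
apply: (le_trans (enorm_le_l1norm _)).
apply: (le_trans (CP _ _ _ _ _ wbar0 B0 zP' k)); rewrite -mulrA ler_wpM2l//.
  exact: le_trans C1.
have e0 : 0 <= enorm (z 0%N) by exact: sqrtr_ge0.
have := l1norm_le_enorm (z 0%N); have Dw : 0 <= D%:R * wbar by rewrite mulr_ge0.
have DB : 0 <= D%:R * B by rewrite mulr_ge0.
have -> : D.+1%:R * (wbar + enorm (z 0%N) + B) =
  D%:R * wbar + D%:R * enorm (z 0%N) + D%:R * B + (wbar + enorm (z 0%N) + B).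
  by rewrite -natr1; ring.
lra.
Qed.

Theorem corollary3 (R : realType) (D : nat) :
  exists Cw : set 'cV[R]_D -> 'M[R]_D -> R,
  forall (V : set 'cV[R]_D) (A : 'M[R]_D),
    polytope V -> V 0 -> posdefmx (2^-1 *: (A + A^T)) ->
    let U := vert V in
    [/\ 1 <= Cw U A,
        (forall (wbar B : R) (z u : nat -> 'cV[R]_D) (w : nat -> R),
           0 <= wbar -> 0 <= B ->
           (forall k : nat,
              [/\ z k.+1 = z k + w k *: u k,
                  0 <= w k <= wbar,
                  U (u k)
                & dotp (A *m z k) (u k) <=
                    minval V (fun v => dotp (A *m z k) v) + B]) ->
           (ereal_sup (range (fun k : nat => (enorm (z k))%:E))
              <= (Cw U A * (wbar + enorm (z 0%N) + B))%:E)%E)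
      & (forall (wbar : R) (z u : nat -> 'cV[R]_D) (w : nat -> R),
           0 <= wbar ->
           (forall k : nat,
              [/\ z k.+1 = z k + w k *: u k,
                  0 <= w k <= wbar
                & (U `&` argmin V (fun v => dotp (A *m z k) v)) (u k)]) ->
           (ereal_sup (range (fun k : nat => (enorm (z k))%:E))
              <= (Cw U A * (wbar + enorm (z 0%N) + 0))%:E)%E)].
Proof.
have /choice[C CP] := @finite_near_greedy_bounded R D.
exists (fun U A => C (U, A)) => V A Vpoly V0 /posdef_positive Apos U.
have [C1 Cbound] := CP (U, A).
have Ufin : finite_set U.
  have [S [Sfin _ VS]] := Vpoly.
  by apply: sub_finite_set Sfin; rewrite /U VS; exact: vert_conv_hull_sub.
have bounded (wbar B : R) (z u : nat -> 'cV[R]_D) (w : nat -> R) :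
    0 <= wbar -> 0 <= B ->
    (forall k : nat, [/\ z k.+1 = z k + w k *: u k, 0 <= w k <= wbar, U (u k)
       & dotp (A *m z k) (u k) <= minval V (dotp (A *m z k)) + B]) ->
    (ereal_sup (range (fun k : nat => (enorm (z k))%:E))
       <= (C (U, A) * (wbar + enorm (z 0%N) + B))%:E)%E.
  move=> wbar0 B0 zP; apply: ge_ereal_sup => _ [k _ <-]; rewrite lee_fin.
  apply: (Cbound Ufin Apos wbar B z u w wbar0 B0) => m.
  have [zS wm Um um] := zP m; split=> //.
    move=> v [Vv _]; apply: (le_trans um); rewrite lerD2r.
    exact: polytope_minval_le.
  apply: (le_trans um); rewrite gerDr.
  by rewrite (le_trans (polytope_minval_le _ Vpoly V0))// -(scale0r 0) dotpZr mul0r.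
split=> // wbar z u w wbar0 zP; apply: (bounded wbar 0 z u w) => // k.
have [zS wm [Uk uk]] := zP k; split=> //.
by rewrite addr0 (argmin_minval uk).
Qed.
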